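(* Let $p$ be a prime, let $\alpha_1,\alpha_2,\alpha_3\in\mathbb{C}_p$, and let \[ F = x^{(3)} - (\alpha_1+\alpha_2+\alpha_3)\,x^{(2)} + (\alpha_1\alpha_2+\alpha_2\alpha_3+\alpha_1\alpha_3)\,x^{(1)} - \alpha_1\alpha_2\alpha_3\, x \in \mathbb{C}_p[\![t]\!]\{x\}. \] Set $u_i=\nu_p(\alpha_i)$ and \[ G^{(2)}_0=G^{(2)}_0(b_1,b_2)=\min\big(u_2+u_3,\; u_2+b_1,\; b_2\big). \] Assume that $u_1<u_2<u_3$. If the initial condition $(b_1,b_2)\in\mathbb{T}^2$ (with $b_0=0$) is not in $V^{\mathrm{trop}}(G^{(2)}_0)$, then the unique extension to a solution $B=\sum_{i\ge0}b_it^i\in\mathbb{T}[\![t]\!]$ in $\bigcap_{n\in\mathbb{N}}\mathcal{S}(\operatorname{trop}(d^nF))$ is \[ b_n=(n-2)u_1+G^{(2)}_0(b_1,b_2)-\nu_p(n!)\qquad (n\ge 3). \]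
   Context: $\mathbb{N}=\{0,1,2,\dots\}$. $(\mathbb{C}_p,\nu_p)$ is the field of $p$-adic complex numbers with its $p$-adic valuation, $\nu_p(0)=\infty$. **Differential polynomials.** For a field $K$, $K[\![t]\!]\{x\}$ is the polynomial ring $K[\![t]\!][x^{(j)}\mid j\in\mathbb{N}]$ (with $x=x^{(0)}$), equipped with the unique derivation $d$ that extends $d/dt$ on $K[\![t]\!]$ and satisfies $d x^{(j)}=x^{(j+1)}$. **Tropical semirings.** $\mathbb{T}=(\mathbb{R}\cup\{\infty\},\min,+)$ and $\mathbb{T}^{(2)}=(\mathbb{R}^2\cup\{\infty\},\min_{\mathrm{lex}},+)$, where $\min_{\mathrm{lex}}$ is the minimum for the lexicographic order on $\mathbb{R}^2$ and $\infty$ is the largest element. For a tropical polynomial $G$ in $b_1,b_2$, $V^{\mathrm{trop}}(G)\subset\mathbb{T}^2$ is the set of points at which the minimum of the terms of $G$ is attained at least twice. **Tropicalization of equations.** Let $K=\mathbb{C}_p$ and $v_K=\nu_p$. Define $v:K[\![t]\!]\to\mathbb{T}^{(2)}$ by $v(\sum_i a_it^i)=(m,v_K(a_m))$, where $m=\min\{i\mid a_i\neq 0\}$, and $v(0)=\infty$. For $f\in K[\![t]\!]\{x\}$, $\operatorname{trop}(f)\in\mathbb{T}^{(2)}[x^{(j)}\mid j\in\mathbb{N}]$ is obtained by applying $v$ to the coefficients of $f$. **Tropical solutions.** $\mathbb{T}[\![t]\!]$ is the semiring of formal power series $B=\sum_{i\ge 0}b_it^i$ with $b_i\in\mathbb{T}$.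 It carries the additive, $\mathbb{T}$-linear differential $(d/dt)_{v_K}$ given by $t^n\mapsto v_K(n)t^{n-1}$ for $n\ge1$ and $t^0\mapsto\infty$; thus the coefficient of $t^{n-1}$ in $(d/dt)_{v_K}(B)$ is $b_n+v_K(n)$. Define $w:\mathbb{T}[\![t]\!]\to\mathbb{T}^{(2)}$ by $w(B)=(m,b_m)$ with $m=\min\{i\mid b_i\neq\infty\}$, and $w(B)=\infty$ if all $b_i=\infty$. A polynomial $f\in\mathbb{T}^{(2)}[x^{(j)}\mid j\in\mathbb{N}]$ is evaluated at $B$ by substituting $w\big((d/dt)_{v_K}^j(B)\big)$ for $x^{(j)}$. $B$ is a tropical solution of $f$ if the resulting minimum, taken in $\mathbb{T}^{(2)}$ over the monomial terms of $f$, is attained at least twice. $\mathcal{S}(f)\subseteq\mathbb{T}[\![t]\!]$ is the set of tropical solutions of $f$.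
   Formalization: The printed claim fails for p=2 (e.g. α=(1,2,4), b_1=5, b_2=0); here G^{(2)}_0 is evaluated at (b_1, b_2+ν_p(2)) instead of (b_1,b_2), both in the hypothesis and in the formula; for odd p this is the same since ν_p(2)=0. *)

(* Defs.v *)
From HB Require Import structures.
From mathcomp Require Import all_boot all_order all_algebra.
From mathcomp Require Import finmap.
From mathcomp Require Import boolp classical_sets reals.
From mathcomp Require Import zify.
From mathcomp.multinomials Require Import monalg.

Set Implicit Arguments.
Unset Strict Implicit.
Unset Printing Implicit Defensive.

Import Order.TTheory GRing.Theory Num.Theory.
Local Open Scope ring_scope.

(* [V] with a largest element [Inf] added: for [V = R] this is the tropical
   semiring T, for [V = lex2 R] (below) it is T^(2). Tropical addition is
   [Num.min], tropical multiplication is the additive notation [+]. *)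
Inductive trop (V : Type) : Type := Fin of V | Inf.
Arguments Inf {V}.

Section TropChoice.
Variable V : Type.
Definition trop_opt (a : trop V) : option V := if a is Fin x then Some x else None.
Definition opt_trop (a : option V) : trop V := if a is Some x then Fin x else Inf.
Lemma trop_optK : cancel trop_opt opt_trop. Proof. by case. Qed.
End TropChoice.

HB.instance Definition _ (V : eqType) := Equality.copy (trop V) (can_type (@trop_optK V)).
HB.instance Definition _ (V : choiceType) := Choice.copy (trop V) (can_type (@trop_optK V)).

Section TropOrder.
Context (d : Order.disp_t).

Section POrder.
Variable V : porderType d.
Definition tle (a b : trop V) : bool :=
  match a, b with
  | _, Inf => true
  | Inf, Fin _ => false
  | Fin x, Fin y => (x <= y)%O
  end.
Lemma tle_refl : reflexive tle. Proof. by case=> [x|] //=. Qed.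
Lemma tle_anti : antisymmetric tle.
Proof. by case=> [x|] [y|] //= /le_anti ->. Qed.
Lemma tle_trans : transitive tle.
Proof. by case=> [x|] [y|] [z|] //=; apply: le_trans. Qed.
HB.instance Definition _ :=
  Order.Le_isPOrder.Build d (trop V) tle_refl tle_anti tle_trans.
End POrder.

Section Total.
Variable V : orderType d.
Lemma tle_total : total (<=%O : rel (trop V)).
Proof. by case=> [x|] [y|] //=; apply: le_total. Qed.
HB.instance Definition _ := Order.POrder_isTotal.Build d (trop V) tle_total.
End Total.
End TropOrder.

Section TropAdd.
Variable V : nmodType.
Definition tadd (a b : trop V) : trop V :=
  match a, b with Fin x, Fin y => Fin (x + y) | _, _ => Inf end.
Lemma taddA : associative tadd.
Proof. by case=> [x|] [y|] [z|] //=; rewrite addrA. Qed.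
Lemma taddC : commutative tadd.
Proof. by case=> [x|] [y|] //=; rewrite addrC. Qed.
Lemma tadd0 : left_id (Fin 0) tadd.
Proof. by case=> [x|] //=; rewrite add0r. Qed.
HB.instance Definition _ := GRing.isNmodule.Build (trop V) taddA taddC tadd0.
End TropAdd.

(* Meaningful for finite arguments only: Inf has no tropical inverse. *)
Definition topp (V : zmodType) (a : trop V) : trop V :=
  if a is Fin x then Fin (- x) else Inf.

Definition lex2 (R : realType) : Type := (R *lexi[ring_display] R)%type.
HB.instance Definition _ (R : realType) := Order.Total.on (lex2 R).
HB.instance Definition _ (R : realType) := GRing.Zmodule.copy (lex2 R) (R * R)%type.

Lemma lex2_le (R : realType) (x y : lex2 R) :
  (x <= y) = (x.1 < y.1) || (x.1 == y.1) && (x.2 <= y.2).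
Proof.
by rewrite [LHS]Order.ProdLexiOrder.leEprodlexi; case: ltgtP.
Qed.

Section TropicalPolynomials.
Variables (I : choiceType) (V : porderZmodType).

(* Tropical polynomials in the variables indexed by [I]; the terms of [f] are
   the monomials in its support, i.e. those with coefficient different from Inf. *)
Definition tpoly : Type := {fsfun {cmonom I} -> trop V with Inf}.

Implicit Types (f : tpoly) (P : I -> trop V) (m : {cmonom I}).

(* [*+] is the tropical power; in particular [Inf *+ 0 = Fin 0]. *)
Definition tterm f P m : trop V := f m + \sum_(i <- finsupp m) P i *+ m i.

Definition teval f P : trop V :=
  \big[Num.min/Inf]_(m <- finsupp f) tterm f P m.

(* The points where the minimum is attained by at least two terms. *)
Definition Vtrop f : set (I -> trop V) := fun P =>
  exists m1 m2, [/\ m1 \in finsupp f, m2 \in finsupp f, m1 != m2,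
    tterm f P m1 = teval f P & tterm f P m2 = teval f P].

End TropicalPolynomials.

(* Formal power series K[[t]], with the Cauchy product. *)
Record fps (K : Type) : Type := Fps { fcoef :> nat -> K }.
HB.instance Definition _ (K : Type) := gen_eqMixin (fps K).
HB.instance Definition _ (K : Type) := gen_choiceMixin (fps K).

Section FormalPowerSeries.
Variable K : comNzRingType.
Implicit Types f g h : fps K.

Lemma fpsP f g : (forall n, f n = g n) -> f = g.
Proof. by case: f g => [f] [g] /= fg; congr Fps; apply: funext. Qed.

Definition fps_zero : fps K := Fps (fun=> 0).
Definition fps_opp f : fps K := Fps (fun n => - f n).
Definition fps_add f g : fps K := Fps (fun n => f n + g n).
Lemma fps_addA : associative fps_add.
Proof. by move=> f g h; apply: fpsP => n /=; rewrite addrA. Qed.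
Lemma fps_addC : commutative fps_add.
Proof. by move=> f g; apply: fpsP => n /=; rewrite addrC. Qed.
Lemma fps_add0 : left_id fps_zero fps_add.
Proof. by move=> f; apply: fpsP => n /=; rewrite add0r. Qed.
Lemma fps_addN : left_inverse fps_zero fps_opp fps_add.
Proof. by move=> f; apply: fpsP => n /=; rewrite addNr. Qed.
HB.instance Definition _ :=
  GRing.isZmodule.Build (fps K) fps_addA fps_addC fps_add0 fps_addN.

Definition fpsC (c : K) : fps K := Fps (fun n => c *+ (n == 0%N)).
Definition fps_mul f g : fps K :=
  Fps (fun n => \sum_(i < n.+1) f i * g (n - i)%N).

Let trunc n f : {poly K} := \poly_(i < n.+1) f i.

Lemma fps_mulE n f g k : (k <= n)%N -> fps_mul f g k = (trunc n f * trunc n g)`_k.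
Proof.
move=> kn; rewrite coefM /=; apply: eq_bigr => i _.
by rewrite !coef_poly !ltnS (leq_trans (leq_ord i) kn) (leq_trans (leq_subr _ _) kn).
Qed.

Lemma fps_mulC : commutative fps_mul.
Proof. by move=> f g; apply: fpsP => n; rewrite !(fps_mulE _ _ (leqnn n)) mulrC. Qed.

Lemma fps_mulA : associative fps_mul.
Proof.
move=> f g h; apply: fpsP => n.
transitivity ((trunc n f * (trunc n g * trunc n h))`_n).
  rewrite coefM /=; apply: eq_bigr => i _.
  by rewrite coef_poly ltn_ord -(fps_mulE _ _ (leq_subr i n)).
rewrite mulrA coefM /=; apply: eq_bigr => i _.
rewrite coef_poly ltnS leq_subr; congr (_ * _).
by rewrite -(@fps_mulE n) // leq_ord.
Qed.

Lemma fps_mul1 : left_id (fpsC 1) fps_mul.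
Proof.
move=> f; apply: fpsP => n /=; rewrite big_ord_recl /= subn0 mul1r big1 ?addr0 //.
by move=> i _; rewrite mul0r.
Qed.

Lemma fps_mulDl : left_distributive fps_mul +%R.
Proof.
move=> f g h; apply: fpsP => n /=; rewrite -big_split /=.
by apply: eq_bigr => i _; rewrite mulrDl.
Qed.

Lemma fps_oner_neq0 : fpsC 1 != 0 :> fps K.
Proof. by apply/eqP => /(congr1 (fun f : fps K => f 0%N)) /eqP /=; rewrite oner_eq0. Qed.

HB.instance Definition _ := GRing.Zmodule_isComNzRing.Build (fps K)
  fps_mulA fps_mulC fps_mul1 fps_mulDl fps_oner_neq0.

Definition fps_deriv f : fps K := Fps (fun n => f n.+1 *+ n.+1).

Lemma fps_derivD f g : fps_deriv (f + g) = fps_deriv f + fps_deriv g.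
Proof. by apply: fpsP => n /=; rewrite mulrnDl. Qed.

Lemma fps_derivM f g :
  fps_deriv (f * g) = fps_deriv f * g + f * fps_deriv g.
Proof.
apply: fpsP => n; rewrite [LHS](_ : _ = (trunc n.+1 f * trunc n.+1 g)^`()`_n); last first.
  by rewrite coef_deriv -(@fps_mulE n.+1).
rewrite derivM coefD !coefM /=.
congr (_ + _); apply: eq_bigr => i _.
- have /andP[h1 h2] : (i.+1 < n.+2)%N && (n - i < n.+2)%N by have := ltn_ord i; lia.
  by rewrite coef_deriv !coef_poly h1 h2.
- have /andP[h1 h2] : (i < n.+2)%N && ((n - i).+1 < n.+2)%N by have := ltn_ord i; lia.
  by rewrite coef_deriv !coef_poly h1 h2.
Qed.

End FormalPowerSeries.

Section DerivationAux.
Variables (S : comNzRingType) (A : comAlgType S).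

Lemma leibniz_monomials (a b a' b' : S) (x y u v : A) :
  (a' * b + a * b') *: (x * y) + (a * b) *: (u * y + x * v) =
  (a' *: x + a *: u) * (b *: y) + (a *: x) * (b' *: y + b *: v).
Proof.
rewrite !mulrDl !mulrDr -!scalerAl -!scalerAr !scalerDl !scalerDr !scalerA.
by rewrite addrACA.
Qed.

Lemma derivation_bilinear (d : A -> A) (J : Type) (r s : seq J) (F G : J -> A) x y :
    {morph d : x y / x + y} -> d 0 = 0 ->
    x = \sum_(i <- r) F i -> y = \sum_(j <- s) G j ->
    (forall i j, d (F i * G j) = d (F i) * G j + F i * d (G j)) ->
  d (x * y) = d x * y + x * d y.
Proof.
move=> dD d0 -> -> dFG.
have dsum (t : seq J) H : d (\sum_(i <- t) H i) = \sum_(i <- t) d (H i).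
  exact: (big_morph d dD d0).
rewrite mulr_suml !dsum !mulr_suml -big_split /=; apply: eq_bigr => i _.
by rewrite !mulr_sumr dsum -big_split /=; apply: eq_bigr => j _.
Qed.

End DerivationAux.

(* K[[t]]{x}: the variable x^(j) is indexed by j : nat. *)
Notation diffpoly K := {malg (fps K)[{cmonom nat}]}.

Section DifferentialPolynomials.
Variable K : comNzRingType.
Implicit Types (f g : diffpoly K) (m : {cmonom nat}) (c : fps K).

Definition dvar (j : nat) : diffpoly K := << ucm j >>.

(* The derivation d: [dpolyD], [dpolyM], [dpolyC] and [dpolyX] show that it is
   additive, satisfies the Leibniz rule, extends d/dt on constants and maps
   x^(j) to x^(j+1); these properties determine it. *)
Definition dmon m : diffpoly K :=
  \sum_(j <- finsupp m) << mmul (divcm m (ucm j)) (ucm j.+1) >> *+ m j.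

Definition dpoly f : diffpoly K :=
  \sum_(m <- msupp f) (<< fps_deriv f@_m *g m >> + f@_m *: dmon m).

Lemma fps_deriv0 : fps_deriv (0 : fps K) = 0.
Proof. by apply: fpsP => n /=; rewrite mul0rn. Qed.

Lemma dpolyEw (d : {fset {cmonom nat}}) f : (msupp f `<=` d)%fset ->
  dpoly f = \sum_(m <- d) (<< fps_deriv f@_m *g m >> + f@_m *: dmon m).
Proof.
move=> fd; rewrite /dpoly; apply/big_fset_incl => //= m _ mf.
by rewrite mcoeff_outdom // fps_deriv0 monalgU0 scale0r addr0.
Qed.

Lemma dpolyD f g : dpoly (f + g) = dpoly f + dpoly g.
Proof.
pose d := (msupp f `|` msupp g)%fset.
rewrite (@dpolyEw d (f + g)) ?msuppD_le // (@dpolyEw d f) ?fsubsetUl //.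
rewrite (@dpolyEw d g) ?fsubsetUr // -big_split /=; apply: eq_bigr => m _.
by rewrite mcoeffD fps_derivD monalgUD scalerDl addrACA.
Qed.

Lemma dpoly0 : dpoly 0 = 0.
Proof. by rewrite /dpoly msupp0 big_nil. Qed.

Lemma dpoly_sum (J : Type) (r : seq J) (F : J -> diffpoly K) :
  dpoly (\sum_(i <- r) F i) = \sum_(i <- r) dpoly (F i).
Proof. exact: (big_morph _ dpolyD dpoly0). Qed.

Lemma monalgUZ c m : c *: << m >> = << c *g m >> :> diffpoly K.
Proof. by rewrite -mul_malgC malgM_def fgmulUU mulr1 mul1m. Qed.

Lemma dpolyU c m : dpoly << c *g m >> = << fps_deriv c *g m >> + c *: dmon m.
Proof.
by rewrite (dpolyEw msuppU_le) big_seq_fset1 mcoeffUU.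
Qed.

Lemma dmonEw (d : {fset nat}) m : (finsupp m `<=` d)%fset ->
  dmon m = \sum_(j <- d) << mmul (divcm m (ucm j)) (ucm j.+1) >> *+ m j.
Proof.
move=> md; rewrite /dmon; apply/big_fset_incl => //= j _.
by rewrite -cmE_eq0 => /eqP ->; rewrite mulr0n.
Qed.

Lemma monalgUU m1 m2 : << m1 >> * << m2 >> = << mmul m1 m2 >> :> diffpoly K.
Proof. by rewrite malgM_def fgmulUU mulr1. Qed.

Lemma dmonM m1 m2 :
  dmon (mmul m1 m2) = dmon m1 * << m2 >> + << m1 >> * dmon m2.
Proof.
pose d := (finsupp m1 `|` finsupp m2)%fset.
rewrite (@dmonEw d (mmul m1 m2)) ?mdomD //.
rewrite (@dmonEw d m1) ?fsubsetUl // (@dmonEw d m2) ?fsubsetUr //.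
rewrite mulr_suml mulr_sumr -big_split /=; apply: eq_bigr => j _.
rewrite [mmul m1 m2 j]cmM [LHS]mulrnDr.
rewrite [X in _ = X + _]mulrnAl [X in _ = _ + X]mulrnAr.
rewrite [X in _ = X *+ _ + _]monalgUU [X in _ = _ + X *+ _]monalgUU.
apply: congr2.
- have [->|m1j] := eqVneq (m1 j) 0%N; first exact: etrans (mulr0n _) (esym (mulr0n _)).
  apply: (congr1 (fun x => << x >> *+ _)).
  apply/eqP/cmP => i; rewrite !cmM !divcmE !cmM !cmU.
  by have [<-|] := eqVneq j i; move: m1j; lia.
- have [->|m2j] := eqVneq (m2 j) 0%N; first exact: etrans (mulr0n _) (esym (mulr0n _)).
  apply: (congr1 (fun x => << x >> *+ _)).
  apply/eqP/cmP => i; rewrite !cmM !divcmE !cmM !cmU.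
  by have [<-|] := eqVneq j i; move: m2j; lia.
Qed.

Lemma dpolyUZ c m :
  dpoly << c *g m >> = fps_deriv c *: << m >> + c *: dmon m.
Proof. exact: etrans (dpolyU c m) (congr2 _ (esym (monalgUZ _ _)) erefl). Qed.

Lemma dpolyUM a b m n :
  dpoly (<< a *g m >> * << b *g n >>) =
  dpoly << a *g m >> * << b *g n >> + << a *g m >> * dpoly << b *g n >>.
Proof.
have E : << a *g m >> * << b *g n >> = << a * b *g mmul m n >> :> diffpoly K.
  exact: etrans (malgM_def _ _) (fgmulUU _ _ _ _).
apply: etrans (congr1 dpoly E) _; apply: etrans (dpolyUZ _ _) _.
apply: etrans (congr2 +%R (congr2 *:%R (fps_derivM a b) (esym (monalgUU m n)))
                          (congr1 ( *:%R (a * b)) (dmonM m n))) _.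
apply: etrans (leibniz_monomials _ _ _ _ _ _ _ _) _.
apply: congr2; apply: congr2.
- exact: esym (dpolyUZ a m).
- exact: monalgUZ b n.
- exact: monalgUZ a m.
- exact: esym (dpolyUZ b n).
Qed.

Lemma dpolyM f g : dpoly (f * g) = dpoly f * g + f * dpoly g.
Proof.
apply: (derivation_bilinear dpolyD dpoly0 (monalgE f) (monalgE g)) => m n.
exact: dpolyUM.
Qed.

Lemma dpolyC c : dpoly c%:MP = (fps_deriv c)%:MP.
Proof.
apply: etrans (dpolyU c _) _.
by rewrite /dmon mdom1 big_seq_fset0 scaler0 addr0.
Qed.

Lemma dpolyX j : dpoly (dvar j) = dvar j.+1.
Proof.
rewrite dpolyU /dmon mdomU big_seq_fset1 scale1r cmUU mulr1n.
have -> : fps_deriv (1 : fps K) = 0.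
  by apply: fpsP => -[|n] /=; rewrite mul0rn.
rewrite monalgU0 add0r /dvar; congr << _ >>.
by apply/eqP/cmP => i; rewrite cmM divcmE subnn add0n.
Qed.

End DifferentialPolynomials.

Section ValuedField.
Variables (R : realType) (K : fieldType) (nu : K -> trop R).

Definition vcauchy (u : nat -> K) : Prop := forall e : R, exists N : nat,
  forall m n, (N <= m)%N -> (N <= n)%N -> Fin e <= nu (u m - u n).

Definition vcvg (u : nat -> K) (l : K) : Prop := forall e : R, exists N : nat,
  forall n, (N <= n)%N -> Fin e <= nu (u n - l).

Definition vclosure (A : set K) : set K :=
  fun x => forall e : R, exists2 y, A y & Fin e <= nu (x - y).

Definition algebraic_over (A : set K) : set K :=
  fun x => exists P : {poly K}, [/\ P != 0, forall i, A P`_i & root P x].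

(* In a complete extension of Q with the p-adic valuation, the closure of Q is
   the field of p-adic numbers. *)
Definition Qp_in : set K := vclosure (range (@ratr K)).

Definition Qpbar_in : set K := algebraic_over Qp_in.

(* (K, nu) is the completion of an algebraic closure of Q_p with the valuation
   normalized by nu p = 1. This determines (K, nu) up to an isomorphism of
   valued fields. *)
Record is_Cp (p : nat) : Prop := IsCp {
  Cp_val_inf : forall x, nu x = Inf <-> x = 0;
  Cp_val_mul : forall x y, nu (x * y) = nu x + nu y;
  Cp_val_add : forall x y, Num.min (nu x) (nu y) <= nu (x + y);
  Cp_val_nat : forall n, (0 < n)%N -> nu n%:R = Fin (logn p n)%:R;
  Cp_complete : forall u, vcauchy u -> exists l, vcvg u l;
  Cp_Qpbar_closed : forall P : {poly K}, (1 < size P)%N ->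
    (forall i, Qpbar_in P`_i) -> exists2 x, Qpbar_in x & root P x;
  Cp_Qpbar_dense : forall x, vclosure Qpbar_in x
}.

Lemma Cp_val_2 (p : nat) : is_Cp p -> prime p -> p != 2%N -> nu 2%:R = 0.
Proof.
move=> hK pp p2; rewrite (Cp_val_nat hK) // lognE pp /=.
by rewrite dvdn_prime2 // (negbTE p2).
Qed.

End ValuedField.

Section Tropicalization.
Variable R : realType.

(* The pair (m, a), with (m, Inf) read as Inf. *)
Definition lex_pair (m : nat) (a : trop R) : trop (lex2 R) :=
  if a is Fin r then Fin (m%:R, r) else Inf.

(* The pair (m, g c_m) for the least index m with c_m <> z; Inf if there is none. *)
Definition least_coef (T : eqType) (z : T) (g : T -> trop R) (c : nat -> T) :
    trop (lex2 R) :=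
  match pselect (exists i, c i != z) with
  | left e => let m := ex_minn e in lex_pair m (g (c m))
  | right _ => Inf
  end.

Variables (K : fieldType) (nu : K -> trop R).

Definition vfps (f : fps K) : trop (lex2 R) := least_coef 0 nu f.

Definition trop_dpoly (f : diffpoly K) : tpoly nat (lex2 R) :=
  [fsfun m in msupp f => vfps f@_m | Inf].

(* A series sum_i B_i t^i over T is represented by its coefficient sequence. *)
Definition wtrop (B : nat -> trop R) : trop (lex2 R) := least_coef Inf id B.

Definition tderiv (B : nat -> trop R) : nat -> trop R :=
  fun n => B n.+1 + nu n.+1%:R.

Definition tsol (f : tpoly nat (lex2 R)) : set (nat -> trop R) :=
  fun B => Vtrop f (fun j => wtrop (iter j tderiv B)).

End Tropicalization.

Section InitialPolynomial.
Variable R : realType.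

(* The tropical polynomial min(u2 + u3, u2 + b1, b2) in two variables; see
   [teval_G20]. The value of the second derivative of sum_i b_i t^i at t = 0 is
   b_2 + nu 2, so it has to be evaluated at (b_1, b_2 + nu 2); for odd p this is
   the point (b_1, b_2), by [Cp_val_2]. *)
Definition G20 (u2 u3 : trop R) : tpoly 'I_2 R :=
  [fsfun m in [fset (mone : {cmonom 'I_2}); ucm ord0; ucm ord_max]%fset =>
    if m == mone then u2 + u3 else if m == ucm ord0 then u2 else 0 | Inf].

Definition point2 (b1 b2 : trop R) : 'I_2 -> trop R :=
  fun i => if i == ord0 then b1 else b2.

Lemma tminA : associative (Num.min : trop R -> trop R -> trop R).
Proof. exact: minA. Qed.
Lemma tminC : commutative (Num.min : trop R -> trop R -> trop R).
Proof. exact: minC. Qed.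
Lemma tmin_inf : left_id Inf (Num.min : trop R -> trop R -> trop R).
Proof. by move=> x; apply/min_idPr; case: x. Qed.
HB.instance Definition _ := Monoid.isComLaw.Build (trop R) Inf
  (Num.min : trop R -> trop R -> trop R) tminA tminC tmin_inf.

Lemma teval_G20 u2 u3 b1 b2 : teval (G20 u2 u3) (point2 b1 b2) =
  Num.min (u2 + u3) (Num.min (u2 + b1) b2).
Proof.
set d := [fset (mone : {cmonom 'I_2}); ucm ord0; ucm ord_max]%fset.
have infD (x : trop R) : Inf + x = Inf by [].
transitivity (\big[Num.min/Inf]_(m <- d) tterm (G20 u2 u3) (point2 b1 b2) m).
  apply: big_fset_incl => [|m _]; first exact: finsupp_sub.
  by rewrite memNfinsupp /tterm => /eqP ->; rewrite infD.
have ne0 : ucm (ord0 : 'I_2) != mone by rewrite cm1_eq1.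
have ne1 : ucm (ord_max : 'I_2) != mone by rewrite cm1_eq1.
have ne2 : ucm (ord_max : 'I_2) != ucm ord0.
  by apply/negP => /cmP /(_ ord0); rewrite !cmU.
have in01 : ucm ord0 \notin [fset ucm (ord_max : 'I_2)]%fset.
  by apply/fset1P => /eqP; rewrite eq_sym (negbTE ne2).
have in0 : mone \notin (ucm ord0 |` [fset ucm (ord_max : 'I_2)])%fset.
  by apply/fset1UP => -[/eqP|/fset1P/eqP]; rewrite eq_sym ?(negbTE ne0) ?(negbTE ne1).
rewrite /d -fsetUA big_fsetU1; last exact: in0.
rewrite big_fsetU1; last exact: in01.
rewrite big_seq_fset1 /=.
have G0 : G20 u2 u3 mone = u2 + u3.
  by rewrite /G20 fsfunE -fsetUA ifT ?eqxx //; apply/fset1UP; left.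
have G1 : G20 u2 u3 (ucm ord0) = u2.
  rewrite /G20 fsfunE -fsetUA (negbTE ne0) eqxx ifT //.
  by apply/fset1UP; right; apply/fset1UP; left.
have G2 : G20 u2 u3 (ucm ord_max) = 0.
  rewrite /G20 fsfunE -fsetUA (negbTE ne1) (negbTE ne2) ifT //.
  by apply/fset1UP; right; apply/fset1UP; right; apply/fset1P.
rewrite /tterm G0 G1 G2 mdom1 !mdomU big_seq_fset0 !big_seq_fset1.
by rewrite !cmUU !mulr1n addr0 add0r.
Qed.

End InitialPolynomial.

Definition F3 (K : fieldType) (a1 a2 a3 : K) : diffpoly K :=
  dvar K 3 - fpsC (a1 + a2 + a3) *: dvar K 2
  + fpsC (a1 * a2 + a2 * a3 + a1 * a3) *: dvar K 1
  - fpsC (a1 * a2 * a3) *: dvar K 0.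

(* Main.v *)
Require Import Defs.
From mathcomp Require Import all_boot all_order all_algebra.
From mathcomp Require Import finmap.
From mathcomp Require Import boolp classical_sets reals.
From mathcomp.multinomials Require Import monalg.
From mathcomp Require Import zify lra.

Import Order.TTheory GRing.Theory Num.Theory.
Local Open Scope ring_scope.

(** Write [c_n = b_n + nu n!], the tropical analogue of the value at [t = 0] of
    the [n]-th derivative.  The [n]-th derivative of [F] is
    [x^(n+3) - e_1 x^(n+2) + e_2 x^(n+1) - e_3 x^(n)] with constant
    coefficients, the elementary symmetric functions of the [a_i], and the
    strict inequalities [u_1 < u_2 < u_3] force [nu e_1 = u_1],
    [nu e_2 = u_1 + u_2], [nu e_3 = u_1 + u_2 + u_3].

    The [j]-th derivative of the series takes a value in T^(2) that is [(0, c_j)]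
    when [c_j] is finite and otherwise exceeds every pair with first component
    [0].  Hence, as soon as one of the three lower terms [nu e + c] of the [n]-th
    equation is strictly smaller than the two others, the minimum of the
    equation is attained twice exactly when [c_(n+3)] equals that term
    ([tsol_linop]): the [n]-th equation then determines [c_(n+3)].

    For [n = 0] the three lower terms are [u_1] plus the three terms of
    [G = min (u_2 + u_3, u_2 + b_1, c_2)], so a strict minimum is exactly what
    the hypothesis on the initial condition provides ([G20_unique_min]), and
    [c_3 = u_1 + G].  For [n >= 1] the term [u_1 + c_(n+2)] is strictly minimal:
    [c_(n+2) = n u_1 + G] while [c_(n+1) >= (n-1) u_1 + G] and
    [u_2 + c_n >= (n-1) u_1 + G], where [G <= c_2] and [G <= u_2 + c_1] give the
    cases in which the left-hand side is an initial coefficient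
    ([dominant_term]).  So [c_(n+3) = (n+1) u_1 + G] for all [n], by strong
    induction.  As each equation is equivalent to this equality, the series given
    by the formula is a solution, and the only one. *)

Set Implicit Arguments.
Unset Strict Implicit.

(** * Minima of tropical polynomials *)

Section TropOrder.
Context {d : Order.disp_t} {V : porderType d}.
Implicit Types x y : V.

Lemma le_Fin x y : (Fin x <= Fin y)%O = (x <= y)%O. Proof. by []. Qed.
Lemma lt_Fin x y : (Fin x < Fin y)%O = (x < y)%O.
Proof. by rewrite !lt_def. Qed.
Lemma le_Inf (a : trop V) : (a <= Inf)%O. Proof. by case: a. Qed.
Lemma lt_Inf (a : trop V) : (Inf < a)%O = false.
Proof. by case: a => [x|]; rewrite lt_def. Qed.
End TropOrder.

Lemma mulrn_Fin (V : nmodType) (x : V) n : (Fin x : trop V) *+ n = Fin (x *+ n).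
Proof. by elim: n => [|n IH] //; rewrite !mulrS IH. Qed.

Section Vtrop.
Variables (I : choiceType) (V : porderZmodType).
Hypothesis totV : total (<=%O : rel V).
Implicit Types (f : tpoly I V) (P : I -> trop V).

Let tot (a b : trop V) : (a >=< b)%O.
Proof. by case: a b => [x|] [y|]; rewrite /Order.comparable //=; exact: totV. Qed.

(** Totality of the order is what makes the iterated minimum a lower bound: in a
    partial order [Num.min] of two incomparable elements is below only one of
    them. *)
Lemma bigmin_seqP (T : eqType) (s : seq T) (F : T -> trop V) i :
  i \in s ->
  \big[Num.min/Inf]_(k <- s) F k = F i <-> {in s, forall k, F i <= F k}.
Proof.
move=> si; have ge k : k \in s -> \big[Num.min/Inf]_(l <- s) F l <= F k.
  elim: s {si} => [//|a s IH]; rewrite inE big_cons => /predU1P[->|/IH h].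
    by rewrite comparable_ge_min // lexx.
  by rewrite comparable_ge_min // h orbT.
split=> [<- //|le_i]; apply/le_anti; rewrite ge //=.
rewrite big_seq; elim/big_ind: _ => [|x y hx hy|k ks]; last exact: le_i.
  exact: le_Inf.
by rewrite comparable_le_min // hx.
Qed.

(** Being the minimum is expressed by inequalities between terms, which spares
    all later arguments the computation of [teval]. *)
Lemma VtropP f P : Vtrop f P <->
  exists m1 m2, [/\ m1 \in finsupp f, m2 \in finsupp f, m1 != m2,
    tterm f P m1 = tterm f P m2 &
    {in finsupp f, forall m, tterm f P m1 <= tterm f P m}].
Proof.
have seqP m : m \in finsupp f -> teval f P = tterm f P m <->
    {in finsupp f, forall k, tterm f P m <= tterm f P k}.
  move=> fm; split=> [e k fk|le_m].
    exact: (iffLR (@bigmin_seqP _ _ (tterm f P) _ fm) e _ fk).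
  by apply/(iffRL (@bigmin_seqP _ _ (tterm f P) _ fm)) => k fk; exact: le_m.
split=> -[m1 [m2 [f1 f2 m12 e1 e2]]]; exists m1, m2; split=> //.
- by rewrite e1 e2.
- by apply/(seqP _ f1); rewrite e1.
- exact/esym/(seqP _ f1).
- by rewrite -e1; exact/esym/(seqP _ f1).
Qed.

Lemma tterm_ucm f P i : tterm f P (ucm i) = f (ucm i) + P i.
Proof. by rewrite /tterm mdomU big_seq_fset1 cmUU mulr1n. Qed.

Lemma tterm_notin f P m : m \notin finsupp f -> tterm f P m = Inf.
Proof. by rewrite memNfinsupp /tterm => /eqP ->. Qed.

(** Two equal minimal terms would put [P] in the tropical variety.  The monomial
    [m0] may be missing from the support; its term is then [Inf], so it can be
    minimal only if all three terms are [Inf], and in that case [m1] and [m2]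
    attain the minimum. *)
Lemma trinomial_unique_min f P m0 m1 m2 :
    m0 != m1 -> m0 != m2 -> m1 != m2 ->
    (forall m, m \in finsupp f -> [\/ m = m0, m = m1 | m = m2]) ->
    m1 \in finsupp f -> m2 \in finsupp f -> ~ Vtrop f P ->
  [\/ tterm f P m0 < tterm f P m1 /\ tterm f P m0 < tterm f P m2,
      tterm f P m1 < tterm f P m0 /\ tterm f P m1 < tterm f P m2 |
      tterm f P m2 < tterm f P m0 /\ tterm f P m2 < tterm f P m1].
Proof.
move=> m01 m02 m12 sub s1 s2 nV.
have s0 : tterm f P m0 != Inf -> m0 \in finsupp f.
  by apply: contraR => /tterm_notin ->.
have pair k l : k \in finsupp f -> l \in finsupp f -> k != l ->
    tterm f P k = tterm f P l -> tterm f P k <= tterm f P m0 ->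
    tterm f P k <= tterm f P m1 -> tterm f P k <= tterm f P m2 -> False.
  move=> fk fl kl ekl x0 x1 x2; apply: nV; apply/VtropP.
  by exists k, l; split=> // m /sub[] ->.
(* Only the three values and the excluded coincidences matter from here on. *)
move: s0 (pair _ _ s1 s2 m12) (fun h => pair _ _ h s1 m01) (fun h => pair _ _ h s2 m02).
move: (tterm f P m0) (tterm f P m1) (tterm f P m2) => a b c s0 p12 p01 p02.
have {}p12 : b = c -> b <= a -> False by move=> e le; apply: p12 => //; rewrite e.
have {}p01 : a = b -> a <= c -> False.
  move=> e le; have [aI|/s0 h] := eqVneq a Inf; last by apply: p01; rewrite -?e.
  by apply: p12; rewrite -e ?lexx //; move: le; rewrite aI; case: c {p01 p02}.
have {}p02 : a = c -> a <= b -> False.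
  move=> e le; have [aI|/s0 h] := eqVneq a Inf; last by apply: p02; rewrite -?e.
  by apply: p01; rewrite -?e //; move: le; rewrite aI; case: b {p12 p02}.
case: (comparable_ltgtP (tot a b)) => h; last by
  case: (comparable_leP (tot a c)) => k; [case: p01|constructor 3; rewrite -?h].
  case: (comparable_ltgtP (tot a c)) => k; first by constructor 1.
    by constructor 3; split=> //; exact: lt_trans h.
  by case: p02 => //; exact: ltW.
case: (comparable_ltgtP (tot b c)) => k; first by constructor 2.
  by constructor 3; split=> //; exact: lt_trans h.
by case: p12 => //; exact: ltW.
Qed.

End Vtrop.

(** * Linear differential operators with constant coefficients *)

Section Linear.
Variable K : comNzRingType.

(** The operator with characteristic polynomial [sum_(j < d) c_j X^j], applied
    to [x^(n)]. *)
Definition linop (c : nat -> K) (d n : nat) : diffpoly K :=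
  \sum_(j < d) fpsC (c j) *: dvar K (n + j).

Lemma fps_derivC (a : K) : fps_deriv (fpsC a) = 0.
Proof. by apply: fpsP => n /=; rewrite mulr0n mul0rn. Qed.

Lemma dpoly_scaleC (a : K) j : dpoly (fpsC a *: dvar K j) = fpsC a *: dvar K j.+1.
Proof.
apply: etrans (congr1 _ (monalgUZ _ _)) _.
rewrite dpolyU fps_derivC monalgU0 add0r; congr (_ *: _).
rewrite /dmon mdomU big_seq_fset1 cmUU mulr1n /dvar; congr << _ >>.
by apply/eqP/cmP => i; rewrite cmM divcmE subnn add0n.
Qed.

Lemma iter_dpoly_linop (c : nat -> K) d n :
  iter n (@dpoly K) (linop c d 0) = linop c d n.
Proof.
elim: n => [//|n IH]; rewrite iterS IH /linop dpoly_sum.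
by apply: eq_bigr => j _; rewrite dpoly_scaleC.
Qed.

Lemma ucm_inj : injective (@ucm nat).
Proof. by move=> i j /eqP/cmP/(_ j); rewrite !cmUU cmU; case: eqVneq. Qed.

Lemma mcoeff_linop (c : nat -> K) d n m : (linop c d n)@_m =
  \sum_(j < d) (fpsC (c j)) *+ (ucm (n + j) == m).
Proof.
rewrite /linop raddf_sum /=; apply: eq_bigr => j _.
by rewrite mcoeffZ mcoeffU; case: eqP => _; rewrite ?mulr1 ?mulr0.
Qed.

Lemma mcoeff_linop_ucm (c : nat -> K) d n k : (k < d)%N ->
  (linop c d n)@_(ucm (n + k)) = fpsC (c k).
Proof.
move=> kd; rewrite mcoeff_linop (bigD1 (Ordinal kd)) //= eqxx big1 ?addr0 // => j.
apply: contraNeq; case: (@eqP _ (ucm _)) => [/ucm_inj/addnI jk _|]; last by rewrite eqxx.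
exact/eqP/val_inj.
Qed.

Lemma mcoeff_linop_neq0 (c : nat -> K) d n m :
  (linop c d n)@_m != 0 -> exists2 k, (k < d)%N & m = ucm (n + k).
Proof.
rewrite mcoeff_linop => h.
have [/existsP[k /eqP <-]|/existsPn nk] := boolP [exists k : 'I_d, ucm (n + k) == m].
  by exists k.
by case/eqP: h; apply: big1 => k _; rewrite (negbTE (nk k)).
Qed.
End Linear.

(** * Tropical solutions of linear equations *)

Section TropicalSolutions.
Variables (R : realType) (K : fieldType) (nu : K -> trop R).
Implicit Types (B : nat -> trop R) (a x y : trop R).

(** Coefficients with respect to the divided powers [t^n / n!]: tropical
    differentiation only shifts them. *)
Definition exp_coef B n : trop R := B n + nu (n`!)%:R.

Lemma lex_pair0_inj : injective (@lex_pair R 0).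
Proof. by case=> [x|] [y|] //= [->]. Qed.

Lemma lex_pair0D x y : lex_pair 0 x + lex_pair 0 y = lex_pair 0 (x + y).
Proof. by case: x y => [x|] [y|] //=; congr Fin; congr pair; rewrite addr0. Qed.

Lemma lt_lex_pair0 x y : (lex_pair 0 x < lex_pair 0 y) = (x < y).
Proof.
case: x y => [x|] [y|] //=; rewrite !ltNge; congr (~~ _).
by rewrite !le_Fin lex2_le /= ltxx eqxx.
Qed.

Lemma wtrop_head B : B 0%N != Inf -> wtrop B = lex_pair 0 (B 0%N).
Proof.
move=> B0; rewrite /wtrop /least_coef; case: pselect => [e|[]]; last by exists 0%N.
by case: ex_minnP => m _ /(_ 0%N B0); rewrite leqn0 => /eqP ->.
Qed.

Lemma wtrop_tail B (r : R) : B 0%N = Inf -> lex_pair 0 (Fin r) < wtrop B.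
Proof.
move=> B0; rewrite /wtrop /least_coef; case: pselect => [e|//].
case: ex_minnP => -[|m]; first by rewrite B0.
case: (B m.+1) => [s|] //= _ _; rewrite lt_Fin ltNge lex2_le /= negb_or negb_and.
by rewrite -leNgt ler0n pnatr_eq0.
Qed.

(** If [B 0] is [Inf], the value of [B] starts with a positive index and so
    exceeds every pair that starts with [0]: a comparison with such a pair only
    sees the constant coefficient of [B]. *)
Lemma lt_wtrop B a y : y < a + B 0%N -> lex_pair 0 y < lex_pair 0 a + wtrop B.
Proof.
have [B0|B0] := eqVneq (B 0%N) Inf; last by rewrite wtrop_head // lex_pair0D lt_lex_pair0.
case: y => [y|]; rewrite ?lt_Inf //; case: a => [a|] // _.
have := wtrop_tail (y - a) B0; case: (wtrop B) => [[m s]|] //=.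
by rewrite !lt_Fin !ltNge !lex2_le /= add0r lerBrDl.
Qed.

Lemma wtrop_eq B a y : y != Inf ->
  lex_pair 0 a + wtrop B = lex_pair 0 y <-> a + B 0%N = y.
Proof.
move=> fy; have [B0|B0] := eqVneq (B 0%N) Inf; last first.
  by rewrite wtrop_head // lex_pair0D; split=> [/lex_pair0_inj|->].
rewrite B0; split=> [h|aI]; last by case: a aI fy => [a|] <-.
have : y < a + B 0%N by rewrite B0; case: y fy {h} => // y _; case: a.
by move/(@lt_wtrop B); rewrite h ltxx.
Qed.

Hypotheses (nu0 : nu 0 = Inf) (nuM : {morph nu : b c / b * c >-> b + c}).
Hypothesis nu1 : nu 1 = 0.

(** Only [i = 0] is used to compute values, but the induction on [j] passes
    through the higher coefficients; the factors [i+1, ..., i+j] that the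
    differentiations produce multiply to the falling factorial. *)
Lemma iter_tderivE B j i : iter j (tderiv nu) B i = B (i + j)%N + nu ((i + j) ^_ j)%:R.
Proof.
elim: j i => [|j IH] i; first by rewrite /= addn0 ffactn0 nu1 addr0.
rewrite iterS {1}/tderiv IH addSnnS -addrA -nuM -natrM; congr (_ + nu _%:R).
by rewrite ffactnSr; congr muln; lia.
Qed.

Lemma iter_tderiv0 B j : iter j (tderiv nu) B 0%N = exp_coef B j.
Proof. by rewrite iter_tderivE add0n ffactnn. Qed.

Lemma vfpsC (c : K) : vfps nu (fpsC c) = lex_pair 0 (nu c).
Proof.
rewrite /vfps /least_coef; case: pselect => [e|nz].
  case: ex_minnP => -[|m] /=; first by rewrite mulr1n.
  by rewrite mulr0n eqxx.
have [->|c0] := eqVneq c 0; first by rewrite nu0.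
by case: nz; exists 0%N.
Qed.

Lemma trop_dpolyE (f : diffpoly K) m : trop_dpoly nu f m = vfps nu f@_m.
Proof.
rewrite /trop_dpoly fsfunE; case: ifPn => // /mcoeff_outdom ->.
by rewrite /vfps /least_coef; case: pselect => // -[i]; rewrite eqxx.
Qed.

(** If term [j] is strictly smaller than the other terms of order below [d],
    two terms can attain the minimum only if they are term [j] and the leading
    one.  This turns the [n]-th equation into a formula for [exp_coef B (n + d)]. *)
Lemma tsol_linop (c : nat -> K) d n j B : nu (c d) = 0 -> (j < d)%N ->
    nu (c j) + exp_coef B (n + j) != Inf ->
    (forall k, (k < d)%N -> k != j ->
      nu (c j) + exp_coef B (n + j) < nu (c k) + exp_coef B (n + k)) ->
  tsol nu (trop_dpoly nu (linop c d.+1 n)) B <->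
  exp_coef B (n + d) = nu (c j) + exp_coef B (n + j).
Proof.
set y := nu (c j) + _ => cd jd fy lt_y; rewrite /tsol.
set f := trop_dpoly _ _; set P := fun j => _.
have tE k : (k < d.+1)%N ->
    tterm f P (ucm (n + k)) = lex_pair 0 (nu (c k)) + wtrop (iter (n + k) (tderiv nu) B).
  by move=> kd; rewrite tterm_ucm trop_dpolyE mcoeff_linop_ucm // vfpsC.
have suppP k : (k < d.+1)%N -> nu (c k) != Inf -> ucm (n + k) \in finsupp f.
  move=> kd fk; rewrite mem_finsupp trop_dpolyE mcoeff_linop_ucm // vfpsC.
  by case: (nu _) fk.
have supp_ucm m : m \in finsupp f -> exists2 k, (k < d.+1)%N & m = ucm (n + k).
  rewrite mem_finsupp trop_dpolyE => fm; apply: (@mcoeff_linop_neq0 _ c).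
  apply: contra_neq fm => ->; rewrite /vfps /least_coef.
  by case: pselect => // -[i]; rewrite eqxx.
have tj : tterm f P (ucm (n + j)) = lex_pair 0 y.
  by rewrite tE 1?ltnW //; apply/wtrop_eq => //; rewrite iter_tderiv0.
have td : tterm f P (ucm (n + d)) = lex_pair 0 y <-> exp_coef B (n + d) = y.
  by rewrite tE // wtrop_eq // iter_tderiv0 cd add0r.
have lt_t k : (k < d)%N -> k != j -> lex_pair 0 y < tterm f P (ucm (n + k)).
  by move=> kd kj; rewrite tE 1?ltnW //; apply: lt_wtrop; rewrite iter_tderiv0 lt_y.
have fj : ucm (n + j) \in finsupp f.
  by apply: suppP; [lia|case: (nu (c j)) @y fy {lt_y tj td lt_t}].
split.
  move/(VtropP _) => []; first exact: le_total.
  move=> m1 [m2 [f1 f2 m12 e12 min1]]; apply/td.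
  have cand m : m \in finsupp f -> tterm f P m <= lex_pair 0 y ->
      m = ucm (n + j) \/ m = ucm (n + d).
    move=> /supp_ucm[k kd ->] le_k.
    have [->|kj] := eqVneq k j; first by left.
    have [->|kd'] := eqVneq k d; first by right.
    by have := lt_t k _ kj; rewrite ltNge le_k => /(_ _)/implyP; lia.
  have le1 : tterm f P m1 <= lex_pair 0 y by rewrite -tj min1.
  have le2 : tterm f P m2 <= lex_pair 0 y by rewrite -e12.
  case: (cand _ f1 le1) m12 e12 => ->; case: (cand _ f2 le2) => ->.
  - by rewrite eqxx.
  - by rewrite tj.
  - by rewrite tj.
  - by rewrite eqxx.
move/td => e; apply/VtropP; first exact: le_total.
exists (ucm (n + j)), (ucm (n + d)); split=> //.
- by apply: suppP => //; rewrite cd.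
- by apply/eqP => /ucm_inj/addnI; lia.
- by rewrite tj e.
move=> m /supp_ucm[k kd ->]; rewrite tj.
have [->|kj] := eqVneq k j; first by rewrite tj.
have [->|kd'] := eqVneq k d; first by rewrite e.
by apply/ltW/lt_t => //; lia.
Qed.

End TropicalSolutions.

(** * Elementary symmetric functions in the valued field *)

Section Cp.
Variables (R : realType) (p : nat) (K : fieldType) (nu : K -> trop R).
Hypothesis hK : is_Cp nu p.

Lemma Cp_val_0 : nu 0 = Inf. Proof. exact/(Cp_val_inf hK). Qed.

Lemma Cp_val_1 : nu 1 = 0.
Proof. by rewrite (Cp_val_nat hK (n := 1)) // logn1. Qed.

Lemma Cp_valN x : nu (- x) = nu x.
Proof.
have h : nu (-1) + nu (-1) = 0 by rewrite -(Cp_val_mul hK) mulrNN mulr1 Cp_val_1.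
rewrite -mulN1r (Cp_val_mul hK); case: (nu (-1)) h => [r|] // [].
by move=> e; have -> : r = 0 by [lra]; rewrite add0r.
Qed.

(** From [x = (x + y) - y], the valuation of [x + y] cannot exceed that of [x]
    when [y] has the larger valuation. *)
Lemma Cp_val_addl x y : nu x < nu y -> nu (x + y) = nu x.
Proof.
move=> xy; apply/le_anti/andP; split; last first.
  by have := Cp_val_add hK x y; rewrite (min_l (ltW xy)).
have := Cp_val_add hK (x + y) (- y); rewrite addrK Cp_valN ge_min.
by case/orP => // /le_lt_trans/(_ xy); rewrite ltxx.
Qed.

Lemma F3_linop (a1 a2 a3 : K) : F3 a1 a2 a3 =
  linop (nth 0 [:: - (a1 * a2 * a3); a1 * a2 + a2 * a3 + a1 * a3;
                  - (a1 + a2 + a3); 1]) 4 0.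
Proof.
have fpsCN (x : K) : fpsC (- x) = - fpsC x.
  by apply: fpsP => n; rewrite /= mulNrn.
rewrite /linop !big_ord_recr big_ord0 /= !fpsCN !scaleNr scale1r add0r.
have rev (V : zmodType) (x y z t : V) : x + y + z + t = t + z + y + x.
  by rewrite addrC [x + y + z]addrC [x + y]addrC !addrA.
exact: rev.
Qed.

(** Distinct valuations leave a single dominant product in each elementary
    symmetric function.  The third valuation may be [Inf]. *)
Lemma Cp_val_sym (a1 a2 a3 : K) : nu a1 < nu a2 -> nu a2 < nu a3 ->
  [/\ nu (a1 + a2 + a3) = nu a1,
      nu (a1 * a2 + a2 * a3 + a1 * a3) = nu a1 + nu a2 &
      nu (a1 * a2 * a3) = nu a1 + nu a2 + nu a3].
Proof.
move=> h12 h23; have e12 := Cp_val_addl h12.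
have lt2 : nu (a1 * a2) < nu (a2 * a3).
  rewrite !(Cp_val_mul hK).
  case: (nu a1) (nu a2) (nu a3) h12 h23 => [x|] [y|] [z|] //=; rewrite !lt_Fin; lra.
have lt3 : nu (a1 * a2) < nu (a1 * a3).
  rewrite !(Cp_val_mul hK).
  case: (nu a1) (nu a2) (nu a3) h12 h23 => [x|] [y|] [z|] //=; rewrite !lt_Fin; lra.
split.
- by rewrite Cp_val_addl e12 // (lt_trans h12).
- by rewrite Cp_val_addl (Cp_val_addl lt2) // (Cp_val_mul hK).
- by rewrite !(Cp_val_mul hK).
Qed.
End Cp.

(** * The initial condition and the dominant term *)

Section G20.
Variable R : realType.

(** The hypothesis on [u2] keeps the monomials of [b1] and [b2] in the support,
    whereas [u3] may be [Inf]. *)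
Lemma G20_unique_min (u2 u3 b1 b2 : trop R) : u2 != Inf ->
    ~ Vtrop (G20 u2 u3) (point2 b1 b2) ->
  [\/ u2 + u3 < u2 + b1 /\ u2 + u3 < b2,
      u2 + b1 < u2 + u3 /\ u2 + b1 < b2 |
      b2 < u2 + u3 /\ b2 < u2 + b1].
Proof.
move=> fu2 nV.
have ne0 : ucm (ord0 : 'I_2) != mone by rewrite cm1_eq1.
have ne1 : ucm (ord_max : 'I_2) != mone by rewrite cm1_eq1.
have ne2 : ucm (ord_max : 'I_2) != ucm ord0.
  by apply/negP => /cmP /(_ ord0); rewrite !cmU.
have f0 : G20 u2 u3 mone = u2 + u3.
  by rewrite /G20 fsfunE -fsetUA ifT ?eqxx //; apply/fset1UP; left.
have f1 : G20 u2 u3 (ucm ord0) = u2.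
  rewrite /G20 fsfunE -fsetUA (negbTE ne0) eqxx ifT //.
  by apply/fset1UP; right; apply/fset1UP; left.
have f2 : G20 u2 u3 (ucm ord_max) = 0.
  rewrite /G20 fsfunE -fsetUA (negbTE ne1) (negbTE ne2) ifT //.
  by apply/fset1UP; right; apply/fset1UP; right; apply/fset1P.
have t0 : tterm (G20 u2 u3) (point2 b1 b2) mone = u2 + u3.
  by rewrite /tterm mdom1 big_seq_fset0 f0 addr0.
have t1 : tterm (G20 u2 u3) (point2 b1 b2) (ucm ord0) = u2 + b1.
  by rewrite tterm_ucm f1.
have t2 : tterm (G20 u2 u3) (point2 b1 b2) (ucm ord_max) = b2.
  by rewrite tterm_ucm f2 add0r.
have := @trinomial_unique_min _ _ (@le_total _ _) (G20 u2 u3) (point2 b1 b2)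
          mone (ucm ord0) (ucm ord_max).
rewrite t0 t1 t2; apply; last exact: nV.
- by rewrite eq_sym; exact: ne0.
- by rewrite eq_sym; exact: ne1.
- by rewrite eq_sym; exact: ne2.
- move=> m /(fsubsetP (finsupp_sub _ _ _)) /fsetUP[/fset2P[->|->]|/fset1P ->].
  + by constructor 1.
  + by constructor 2.
  + by constructor 3.
- by rewrite mem_finsupp f1.
- by rewrite mem_finsupp f2.
Qed.

(** The sequence [C] stands for the coefficients [exp_coef B], and [e] for the
    valuations of the coefficients of the equation.  For [n = 0] the dominant term
    depends on the initial condition; for [n >= 1] it is the one with [j = 2],
    because [r1 < r2] and [Fin r2 < u3]. *)
Lemma dominant_term (r1 r2 : R) u3 (C e : nat -> trop R) (g : R) n :
    r1 < r2 -> Fin r2 < u3 -> C 0%N = 0 ->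
    e 0%N = Fin (r1 + r2) + u3 -> e 1%N = Fin (r1 + r2) -> e 2%N = Fin r1 ->
    ~ Vtrop (G20 (Fin r2) u3) (point2 (C 1%N) (C 2%N)) ->
    teval (G20 (Fin r2) u3) (point2 (C 1%N) (C 2%N)) = Fin g ->
    (forall k, (3 <= k < n + 3)%N -> C k = Fin (r1 *+ (k - 2) + g)) ->
  exists j, [/\ (j < 3)%N, e j + C (n + j)%N = Fin (r1 *+ (n + 1) + g) &
    forall k, (k < 3)%N -> k != j -> e j + C (n + j)%N < e k + C (n + k)%N].
Proof.
move=> r12 r23 C0 e0 e1 e2 nV; rewrite teval_G20 => gE Cn.
have FinD (x y : R) : Fin (x + y) = Fin x + Fin y by [].
have [gA gB gC] : [/\ Fin g <= Fin r2 + u3, Fin g <= Fin r2 + C 1%N & Fin g <= C 2%N].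
  by rewrite -gE !ge_min !lexx !orbT.
case: n Cn => [|n] Cn.
  have lt1 x y : x < y -> Fin r1 + x < Fin r1 + y.
    by case: x y => [x|] [y|] //=; rewrite !lt_Fin ltrD2l.
  have E0 : e 0%N + C (0 + 0)%N = Fin r1 + (Fin r2 + u3).
    by rewrite e0 C0 addr0 FinD addrA.
  have E1 : e 1%N + C (0 + 1)%N = Fin r1 + (Fin r2 + C 1%N).
    by rewrite e1 FinD addrA.
  have E2 : e 2%N + C (0 + 2)%N = Fin r1 + C 2%N by rewrite e2.
  have gE' x : x = Fin g -> Fin r1 + x = Fin (r1 *+ (0 + 1) + g) by move=> ->.
  case: (G20_unique_min _ nV) => // -[h k].
  - exists 0%N; split=> //.
      by rewrite E0; apply: gE'; rewrite -gE min_l // le_min !ltW.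
    by case=> [|[|[|]]] // _ _; rewrite E0 ?E1 ?E2 lt1.
  - exists 1%N; split=> //.
      by rewrite E1; apply: gE'; rewrite -gE (min_l (ltW k)) min_r // ltW.
    by case=> [|[|[|]]] // _ _; rewrite E1 ?E0 ?E2 lt1.
  - exists 2%N; split=> //.
      by rewrite E2; apply: gE'; rewrite -gE (min_r (ltW k)) min_r // ltW.
    by case=> [|[|[|]]] // _ _; rewrite E2 ?E1 ?E0 lt1.
(* The bound holds at [k = 2] because [g] is a minimum, above by the formula. *)
have lb k : (2 <= k < n.+1 + 3)%N -> Fin (r1 *+ (k - 2) + g) <= C k.
  move=> hk; have [->|k2] := eqVneq k 2%N; first by rewrite mulr0n add0r.
  by rewrite Cn //; lia.
have E2 : e 2%N + C (n.+1 + 2)%N = Fin (r1 *+ (n.+1 + 1) + g).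
  rewrite e2 Cn; last by lia.
  by congr Fin; rewrite addnK addrA -mulrS addn1.
(* For [n = 0] this is [g <= r2 + C 1]; otherwise it follows from [lb] and
   [r1 < r2]. *)
have lb0 : Fin (r1 *+ n + g) <= Fin r2 + C n.+1.
  case: n {Cn E2} lb => [|n] lb; first by rewrite mulr0n add0r.
  have /lb : (2 <= n.+2 < n.+2 + 3)%N by lia.
  have -> : (n.+2 - 2 = n)%N by lia.
  by case: (C _) => [c|] //; rewrite !le_Fin mulrS => ?; lra.
have /lb lb1 : (2 <= n.+2 < n.+1 + 3)%N by lia.
exists 2%N; split=> //; rewrite E2 addn1 !mulrS.
case=> [|[|[|]]] // _ _.
- rewrite e0 addn0; case: (C _) u3 r23 lb0 {gA gE nV e0} => [c|] [r3|] //=.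
  rewrite !le_Fin !lt_Fin; lra.
- rewrite e1 addn1; have nE : (n.+2 - 2 = n)%N by lia.
  rewrite nE in lb1.
  case: (C _) lb1 => [c|] //=; rewrite le_Fin lt_Fin; lra.
Qed.
End G20.

(** * The recursion *)

Unset Implicit Arguments.

Theorem theorem2 (R : realType) (p : nat) (K : fieldType) (nu : K -> trop R)
    (hp : prime p) (hK : is_Cp nu p)
    (a1 a2 a3 : K) (h12 : nu a1 < nu a2) (h23 : nu a2 < nu a3)
    (b1 b2 : trop R)
    (hb : ~ Vtrop (G20 (nu a2) (nu a3)) (point2 b1 (b2 + nu 2%:R))) :
  let sol (B : nat -> trop R) : Prop :=
    [/\ B 0%N = 0, B 1%N = b1, B 2%N = b2 &
        (\bigcap_(n in [set: nat])
           tsol nu (trop_dpoly nu (iter n (@dpoly K) (F3 a1 a2 a3))))%classic B] in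
  (exists! B, sol B) /\
  (forall B, sol B -> forall n : nat, (3 <= n)%N ->
     B n = nu a1 *+ (n - 2)
           + teval (G20 (nu a2) (nu a3)) (point2 b1 (b2 + nu 2%:R))
           + topp (nu (n`!)%:R)).
Proof.
set c := nth 0 [:: - (a1 * a2 * a3); a1 * a2 + a2 * a3 + a1 * a3; - (a1 + a2 + a3); 1].
move=> sol.
have nu1 := Cp_val_1 hK.
have [val1 val2 val3] := Cp_val_sym hK h12 h23.
have [r1 r1E] : exists r, nu a1 = Fin r.
  by case: (nu a1) h12 => [r|]; [exists r|rewrite lt_Inf].
have [r2 r2E] : exists r, nu a2 = Fin r.
  by case: (nu a2) h23 => [r|]; [exists r|rewrite lt_Inf].
have r12 : r1 < r2 by move: h12; rewrite r1E r2E lt_Fin.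
have [g gE] : exists g, teval (G20 (nu a2) (nu a3)) (point2 b1 (b2 + nu 2%:R)) = Fin g.
  (* A strict minimum lies below another term, hence is finite. *)
  suff [z] : exists z, teval (G20 (nu a2) (nu a3)) (point2 b1 (b2 + nu 2%:R)) < z.
    by case: (teval _ _) => [g|]; [exists g|rewrite lt_Inf].
  rewrite teval_G20; have fu2 : nu a2 != Inf by rewrite r2E.
  by case: (G20_unique_min fu2 hb) => -[h _]; eexists; apply: (le_lt_trans _ h);
    rewrite !ge_min lexx ?orbT.
have fact_fin n : exists r, nu n`!%:R = Fin r.
  by exists (logn p n`!)%:R; rewrite (Cp_val_nat hK) // fact_gt0.
pose closed k : trop R := Fin (r1 *+ (k - 2) + g).
have coefE B : B 0%N = 0 -> B 1%N = b1 -> B 2%N = b2 ->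
    [/\ exp_coef nu B 0 = 0, exp_coef nu B 1 = b1 & exp_coef nu B 2 = b2 + nu 2%:R].
  by move=> B0 B1 B2; rewrite /exp_coef B0 B1 B2 fact0 factS fact0 muln1 nu1 !addr0.
have step B n : B 0%N = 0 -> B 1%N = b1 -> B 2%N = b2 ->
    (forall k, (3 <= k < n + 3)%N -> exp_coef nu B k = closed k) ->
  tsol nu (trop_dpoly nu (iter n (@dpoly K) (F3 a1 a2 a3))) B <->
  exp_coef nu B (n + 3) = closed (n + 3)%N.
  move=> B0 B1 B2 prev; have [C0 C1 C2] := coefE B B0 B1 B2.
  have [] := @dominant_term R r1 r2 (nu a3) (exp_coef nu B) (nu \o c) g n.
  - exact: r12.
  - by rewrite -r2E.
  - exact: C0.
  - by rewrite /= (Cp_valN hK) val3 r1E r2E.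
  - by rewrite /= val2 r1E r2E.
  - by rewrite /= (Cp_valN hK) val1 r1E.
  - by rewrite C1 C2 -r2E.
  - by rewrite C1 C2 -r2E.
  - exact: prev.
  move=> j [j3 jE jlt].
  have nE : (n + 3 - 2 = n + 1)%N by lia.
  rewrite F3_linop iter_dpoly_linop /closed nE -jE.
  apply: (tsol_linop (Cp_val_0 hK) (Cp_val_mul hK) nu1) => //.
  by have := jE => /= ->.
have closedP B n : exp_coef nu B n = closed n <->
    B n = nu a1 *+ (n - 2) + Fin g + topp (nu n`!%:R).
  rewrite /exp_coef /closed r1E mulrn_Fin; have [r ->] := fact_fin n.
  case: (B n) => [x|] //=; split=> [[e]|[->]]; congr Fin; last by rewrite addrNK.
  by rewrite -e addrK.
have formula B : sol B -> forall n, (3 <= n)%N -> exp_coef nu B n = closed n.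
  case=> B0 B1 B2 solB; elim/ltn_ind => n IH n3.
  have nE : (n = n - 3 + 3)%N by lia.
  rewrite nE; apply/step => //; last exact: solB.
  by move=> k hk; apply: IH; lia.
split; last first.
  by move=> B /formula h n n3; rewrite gE; apply/closedP/h.
pose B n := if n is k.+3 then nu a1 *+ (n - 2) + Fin g + topp (nu n`!%:R)
            else nth Inf [:: 0; b1; b2] n.
have solB : sol B.
  split=> // n _; apply/step => //.
    by move=> [|[|[|k]]] // _; apply/closedP.
  by rewrite addnC; apply/closedP.
exists B; split=> // B' solB'; apply: funext => n.
have [B0 B1 B2 _] := solB'.
case: n => [|[|[|n]]] //; rewrite -/(B _).
exact/esym/closedP/formula.
Qed.
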